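(* Let $n,k,m$ be positive integers and let $\mathcal{F}$ be either $\mathrm{Inj}_m(n,k)$ or $\mathrm{Sur}_1(n,k)$. Then under the action of the whirling map $\mathbf{w}$ on $\mathcal{F}$, for every $j\in[k]$ the statistic $\eta_j$ is $\frac{n}{k}$-mesic; that is, for every $\mathbf{w}$-orbit $O\subseteq\mathcal{F}$, $$\frac{1}{\#O}\sum_{f\in O}\eta_j(f)=\frac{n}{k}.$$
   Context: Notation: $[n]=\{1,\dots,n\}$. $\mathrm{Inj}_m(n,k)$ is the set of functions $f:[n]\to[k]$ with $\#f^{-1}(t)\le m$ for every $t\in[k]$. $\mathrm{Sur}_m(n,k)$ is the set of functions $f:[n]\to[k]$ with $\#f^{-1}(t)\ge m$ for every $t\in[k]$ (so $\mathrm{Sur}_1(n,k)$ is the set of surjections). Whirling: for a family $\mathcal{F}$ of functions $[n]\to[k]$ and $i\in[n]$, the map $w_i:\mathcal{F}\to\mathcal{F}$ (''whirling at index $i$'') sends $f\in\mathcal{F}$ to the function obtained by repeatedly adding $1$ modulo $k$ to the value of $f$ at $i$ (residues represented in $[k]$, all other values unchanged, at least one addition performed), stopping the first time the resulting function is in $\mathcal{F}$. Each $w_i$ is a bijection of $\mathcal{F}$. The whirling map is $\mathbf{w}=w_n\circ\cdots\circ w_2\circ w_1$ (so $w_1$ is applied first). For $j\in[k]$, $\eta_j(f)=\#f^{-1}(\{j\})$. A statistic $g:\mathcal{F}\to\mathbb{R}$ is $c$-mesic under an invertible map on $\mathcal{F}$ with finite orbits if its average over every orbit equals $c$. *)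

(* Defs.v *)
From mathcomp Require Import all_boot all_order all_algebra all_fingroup.

Set Implicit Arguments.
Unset Strict Implicit.
Unset Printing Implicit Defensive.

Import GRing.Theory.

(* [n] and [k] are rendered as 'I_n and 'I_k, i.e. shifted down by one. The
   shift turns "add 1 modulo k, residues represented in [k]" (so k |-> 1) into
   ordS : 'I_k -> 'I_k (so k.-1 |-> 0), and preserves the order of indices. *)

Section Functions.

Variables n k : nat.
Implicit Types (f : {ffun 'I_n -> 'I_k}) (i : 'I_n) (j : 'I_k) (m : nat).

Definition eta j f : nat := #|f @^-1: [set j]|.

Definition Inj m : {set {ffun 'I_n -> 'I_k}} :=
  [set f | [forall t, eta t f <= m]].

Definition Sur m : {set {ffun 'I_n -> 'I_k}} :=
  [set f | [forall t, m <= eta t f]].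

Definition incr_at i f : {ffun 'I_n -> 'I_k} :=
  [ffun x => if x == i then ordS (f x) else f x].

Lemma iter_incr_at t i f x :
  iter t (incr_at i) f x = (if x == i then iter t (@ordS k) (f x) else f x).
Proof.
elim: t => [|t IHt]; first by case: ifP.
by rewrite iterS ffunE IHt; case: (x == i).
Qed.

Lemma val_iter_ordS t j : iter t (@ordS k) j = (j + t) %% k :> nat.
Proof.
elim: t => [|t IHt]; first by rewrite addn0 modn_small.
by rewrite iterS /= IHt -addn1 modnDml addn1 addnS.
Qed.

Lemma iter_incr_at_period i f : iter k (incr_at i) f = f.
Proof.
apply/ffunP => x; rewrite iter_incr_at; case: ifP => // _.
by apply/ord_inj; rewrite val_iter_ordS modnDr modn_small.
Qed.

Lemma incr_at_inj i : injective (incr_at i).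
Proof.
move=> f g /ffunP efg; apply/ffunP => x; have := efg x; rewrite !ffunE.
by case: ifP => // _; apply: ordS_inj.
Qed.

Section Whirling.

Variable F : {set {ffun 'I_n -> 'I_k}}.

Local Notation elt := {f : {ffun 'I_n -> 'I_k} | f \in F}.

Lemma whirl_at_ex i (f : elt) :
  exists t, (0 < t) && (iter t (incr_at i) (val f) \in F).
Proof.
exists k; rewrite iter_incr_at_period (valP f) andbT.
exact: leq_ltn_trans (leq0n _) (ltn_ord (val f i)).
Qed.

Definition whirl_steps i (f : elt) : nat := ex_minn (whirl_at_ex i f).

Lemma whirl_at_subproof i (f : elt) :
  iter (whirl_steps i f) (incr_at i) (val f) \in F.
Proof. by rewrite /whirl_steps; case: ex_minnP => t /andP[]. Qed.

Definition whirl_at_fun i (f : elt) : elt :=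
  exist (fun g => g \in F) _ (whirl_at_subproof i f).

Lemma whirl_at_inj i : injective (whirl_at_fun i).
Proof.
move=> f g /(congr1 val); rewrite /= /whirl_steps.
case: ex_minnP => a /andP[a0 _] mina; case: ex_minnP => b /andP[b0 _] minb.
have iter_inj t : injective (iter t (incr_at i)).
  by elim: t => [|t IHt] x y //= /incr_at_inj/IHt.
have key (u v : elt) c d : 0 < c ->
    (forall t, (0 < t) && (iter t (incr_at i) (val v) \in F) -> d <= t) ->
    c <= d ->
    iter c (incr_at i) (val u) = iter d (incr_at i) (val v) -> u = v.
  move=> c0 mind lecd; rewrite -(subnKC lecd) iterD => /iter_inj euv.
  have [e|lt0] := posnP (d - c); first by apply/val_inj; rewrite euv e.
  have := mind (d - c); rewrite lt0 -euv (valP u) => /(_ isT).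
  by rewrite leqNgt ltn_subrL c0 (leq_trans c0 lecd).
by case: (leqP a b) => [le|/ltnW le] e; [|symmetry]; apply: key le _.
Qed.

Definition whirl_at i : {perm elt} := perm (@whirl_at_inj i).

(* Permutations compose left to right, (s * t) x = t (s x), so the factor of
   the smallest index is applied first. *)
Definition whirl : {perm elt} := (\prod_(i < n) whirl_at i)%g.

End Whirling.

End Functions.

Definition mesic (R : numFieldType) (T : finType) (tau : {perm T}) (c : R)
    (g : T -> R) : Prop :=
  forall O : {set T}, O \in porbits tau ->
    (#|O|%:R^-1 * \sum_(x in O) g x = c)%R.

(* Main.v *)
Require Import Defs.
From mathcomp Require Import all_boot all_order all_algebra all_fingroup.
From mathcomp Require Import zify.

(* Start from [f] and whirl at indices 1, ..., n, 1, ..., n, ... forever, and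
   let [x_t] be the value that is about to be changed at time [t]; the values
   of the current function are then [x_t, ..., x_(t+n-1)].  For consecutive
   residues [v] and [v+1], let [E t] be the number of [v]'s minus the number of
   [v+1]'s among [x_0, ..., x_(t-1)], and [D t] the same difference with the
   [v+1]'s counted up to [x_(t+n-1)] instead.  For [Inj_m], [E (t+n) <= D t + m]
   because a window contains at most [m] copies of [v]; and [D] increases only
   when a [v] skips [v+1], which requires [m] copies of [v+1] in the window,
   that is, [D + m = E].  Hence [E] is bounded above, so that on an orbit [v]
   occurs at most as often as [v+1].  Going around the cycle of residues, all
   these inequalities are equalities.  For [Sur_1] the same argument applies to
   [- E] and [- D], with [m] replaced by [-1]: now [- D] increases only when a
   [v+1] is kept, being the only copy in the window. *)

Set Implicit Arguments.
Unset Strict Implicit.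
Unset Printing Implicit Defensive.

Import Order.TTheory GRing.Theory Num.Theory.

(** By induction on [t], one constant bounds [D t + m] and all [E s] with [s < t + n]: each new [E]
    is bounded through an older [D], and [D] rises only to a level bounded by an [E] already
    covered, since [0 < n]. *)
Lemma delayed_bounded (n : nat) (m : int) (E D : nat -> int) :
    (0 < n)%N ->
    (forall t, E (t + n)%N <= D t + m)%R ->
    (forall t, D t < D t.+1 -> D t.+1 + m <= E t.+1)%R ->
  exists C, forall t, (E t <= C)%R.
Proof.
move=> n_gt0 leED upD.
have [C [CD CE]] : exists C, (D 0 + m <= C)%R /\
    forall s, s < n -> (E s <= C)%R.
  elim: {leED upD n_gt0}n => [|p [C [CD CE]]]; first by exists (D 0 + m)%R.
  exists (Num.max C (E p)); split=> [|s]; first by rewrite le_max CD.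
  rewrite ltnS leq_eqVlt le_max => /orP[/eqP->|/CE->//].
  by rewrite lexx orbT.
exists C => t.
suff [_ H] : (D t + m <= C)%R /\ forall s, s < t + n -> (E s <= C)%R.
  by apply: H; lia.
elim: t => [|t [IHD IHE]]; first by split.
have lt_step : forall s, s < t.+1 + n -> (E s <= C)%R.
  move=> s; rewrite addSn ltnS leq_eqVlt => /orP[/eqP->|/IHE//].
  exact: le_trans (leED t) IHD.
split=> //.
have [/upD le1|le1] := ltP (D t) (D t.+1).
  by apply: le_trans le1 _; apply: lt_step; lia.
by apply: le_trans IHD; rewrite lerD2r.
Qed.

Lemma ordS_chain (k : nat) (r : rel 'I_k) :
    reflexive r -> transitive r -> (forall v, r v (ordS v)) ->
  forall u v, r u v.
Proof.
move=> rr rt rS u v.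
(* From [u], [k - u] steps wrap around to 0 and [v] more steps reach [v]. *)
have -> : v = iter (v + (k - u)) (@ordS k) u.
  apply/ord_inj; rewrite val_iter_ordS addnCA subnKC; last exact: ltnW.
  by rewrite modnDr modn_small.
by elim: (v + _) => //= t IHt; apply: rt IHt (rS _).
Qed.

Lemma sum_porbit (T : finType) (w : {perm T}) (g : T -> nat) (x : T) :
  \sum_(y in porbit w x) g y = \sum_(p < #|porbit w x|) g ((w ^+ p)%g x).
Proof.
rewrite -(big_mkord xpredT (fun p => g ((w ^+ p)%g x))).
rewrite -(eq_bigl _ _ (fun y => esym (porbit_traject w x y))).
rewrite -big_uniq ?uniq_traject_porbit //=.
elim: #|_| => [|p IHp]; first by rewrite big_nil big_geq.
by rewrite trajectSr -cats1 big_cat big_seq1 IHp [RHS]big_nat_recr //= permX.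
Qed.

Section Counting.

Variables n k : nat.
Implicit Types (f : {ffun 'I_n -> 'I_k}) (i : 'I_n) (u v : 'I_k).

Lemma eta_sum u f : eta u f = \sum_i (f i == u).
Proof.
rewrite /eta -sum1_card big_mkcond; apply: eq_bigr => i _.
by rewrite !inE; case: eqP.
Qed.

Lemma eta_at i u f : eta u f = (f i == u) + \sum_(x | x != i) (f x == u).
Proof. by rewrite eta_sum (bigD1 i). Qed.

Lemma sum_eta f : \sum_u eta u f = n.
Proof.
under eq_bigr do rewrite eta_sum.
rewrite exchange_big -[RHS]card_ord -sum1_card; apply: eq_bigr => i _.
rewrite (bigD1 (f i)) //= eqxx big1 ?addn0 // => u.
by rewrite eq_sym => /negPf->.
Qed.

Lemma InjP m f : reflect (forall v, eta v f <= m) (f \in Inj n k m).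
Proof. by rewrite inE; apply: forallP. Qed.

Lemma InjPn m f : f \notin Inj n k m -> exists v, m < eta v f.
Proof. by rewrite inE negb_forall => /existsP[v]; rewrite -ltnNge; exists v. Qed.

Lemma SurP m f : reflect (forall v, m <= eta v f) (f \in Sur n k m).
Proof. by rewrite inE; apply: forallP. Qed.

Lemma SurPn m f : f \notin Sur n k m -> exists v, eta v f < m.
Proof. by rewrite inE negb_forall => /existsP[v]; rewrite -ltnNge; exists v. Qed.

Section Whirl.

Variable F : {set {ffun 'I_n -> 'I_k}}.
Local Notation elt := {f : {ffun 'I_n -> 'I_k} | f \in F}.
Implicit Type g : elt.

(* Naming the projection keeps the carrier of its implicit predicate out of
   the terms, so that [lia] sees equal atoms as equal. *)
Definition elt_fun g : {ffun 'I_n -> 'I_k} := sval g.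

Lemma whirl_at_off i g x :
  x != i -> elt_fun (whirl_at F i g) x = elt_fun g x.
Proof. by move=> /negPf ne; rewrite /elt_fun permE /= iter_incr_at ne. Qed.

Lemma eta_whirl_at i g u :
  eta u (elt_fun (whirl_at F i g)) + (elt_fun g i == u)
    = eta u (elt_fun g) + (elt_fun (whirl_at F i g) i == u).
Proof.
rewrite !(eta_at i u).
under eq_bigr => x ne do rewrite (whirl_at_off _ ne).
by rewrite addnAC [RHS]addnAC [X in X + _]addnC.
Qed.

Lemma whirl_at_skip i g :
  elt_fun (whirl_at F i g) i != ordS (elt_fun g i) -> incr_at i (elt_fun g) \notin F.
Proof.
apply: contraNN => gF; rewrite /elt_fun permE /= /whirl_steps.
case: ex_minnP => t /andP[t_gt0 _] /(_ 1 gF) t_le1.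
have -> : t = 1 by lia.
by rewrite /= ffunE eqxx.
Qed.

Lemma eta_incr_at i f u :
  eta u (incr_at i f) + (f i == u) = eta u f + (ordS (f i) == u).
Proof.
rewrite !(eta_at i u) ffunE eqxx.
under eq_bigr => x /negPf ne do rewrite ffunE ne.
by rewrite addnAC [RHS]addnAC [X in X + _]addnC.
Qed.

Lemma Inj_elt m g v : F = Inj n k m -> eta v (elt_fun g) <= m.
Proof. by move=> FI; move: v; apply/InjP; rewrite -FI; apply: (svalP g). Qed.

Lemma Sur_elt m g v : F = Sur n k m -> m <= eta v (elt_fun g).
Proof. by move=> FS; move: v; apply/SurP; rewrite -FS; apply: (svalP g). Qed.

(** The increment can break the bound only at the successor value, so [m] copies of it sit at other
    indices, which whirling leaves alone. *)
Lemma Inj_whirl_at_skip m i g : F = Inj n k m ->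
    elt_fun (whirl_at F i g) i != ordS (elt_fun g i) ->
  m <= eta (ordS (elt_fun g i)) (elt_fun (whirl_at F i g)).
Proof.
move=> FI skip; have /InjPn[u lt_m] : incr_at i (elt_fun g) \notin Inj n k m.
  by rewrite -FI whirl_at_skip.
have gm v := @Inj_elt m g v FI.
have := eta_incr_at i (elt_fun g) u; have := eta_whirl_at i g u; have := gm u.
case: (ordS (elt_fun g i) =P u) => [eu|_ /=]; last by lia.
by rewrite -eu (negPf skip) eu /=; lia.
Qed.

(** The increment can lose only the value at [i], which is therefore its single copy; whirling must
    go all the way round to restore it. *)
Lemma Sur_whirl_at_skip i g : F = Sur n k 1 ->
    elt_fun (whirl_at F i g) i != ordS (elt_fun g i) ->
  elt_fun (whirl_at F i g) i = elt_fun g i /\ eta (elt_fun g i) (elt_fun (whirl_at F i g)) = 1.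
Proof.
move=> FS skip; have /SurPn[u lt_1] : incr_at i (elt_fun g) \notin Sur n k 1.
  by rewrite -FS whirl_at_skip.
have gm h v := @Sur_elt 1 h v FS.
have := eta_incr_at i (elt_fun g) u; have := eta_whirl_at i g u.
have := gm g u; have := gm (whirl_at F i g) u.
case: (elt_fun g i =P u) => [eu|_ /=]; last by lia.
rewrite eu; case: (elt_fun (whirl_at F i g) i =P u) => [->|_] /=; last by lia.
by split=> //; lia.
Qed.

(** * The infinite sequence of values about to be changed *)

Section Orbit.

Hypothesis n_gt0 : 0 < n.

Definition cyc_index (t : nat) : 'I_n := Ordinal (ltn_pmod t n_gt0).

Definition whirl_upto (t : nat) : {perm elt} :=
  (\prod_(0 <= s < t) whirl_at F (cyc_index s))%g.

Lemma whirl_uptoS t g :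
  whirl_upto t.+1 g = whirl_at F (cyc_index t) (whirl_upto t g).
Proof. by rewrite /whirl_upto big_nat_recr //= permM. Qed.

Lemma whirl_upto_rows q : whirl_upto (q * n) = (whirl F ^+ q)%g.
Proof.
elim: q => [|q IHq]; first by rewrite /whirl_upto big_geq.
rewrite expgSr -IHq mulSn addnC /whirl_upto (@big_cat_nat _ _ _ (q * n)) ?leq_addr //=.
congr (_ * _)%g; rewrite -{1}[q * n]add0n big_addn addKn big_mkord.
apply: eq_bigr => i _; congr (whirl_at F _); apply/ord_inj => /=.
by rewrite addnC modnMDl modn_small.
Qed.

Lemma cyc_index_inj t (r s : nat) : r < n -> s < n ->
  cyc_index (t + r) = cyc_index (t + s) -> r = s.
Proof.
move=> rn sn /(congr1 val) /= /eqP.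
by rewrite eqn_modDl !modn_small // => /eqP.
Qed.

Definition cyc_value g (t : nat) : 'I_k := elt_fun (whirl_upto t g) (cyc_index t).

(** The index due at time [t + s] is not visited in the [s < n] steps before. *)
Lemma cyc_value_window g t s : s < n ->
  cyc_value g (t + s) = elt_fun (whirl_upto t g) (cyc_index (t + s)).
Proof.
move=> sn; rewrite /cyc_value.
suff H r : r <= s -> elt_fun (whirl_upto (t + r) g) (cyc_index (t + s))
    = elt_fun (whirl_upto t g) (cyc_index (t + s)) by apply: H.
elim: r => [|r IHr] rs; first by rewrite addn0.
rewrite addnS whirl_uptoS whirl_at_off ?IHr 1?ltnW //.
by apply/eqP => /cyc_index_inj; lia.
Qed.

Definition cyc_count g v (t : nat) : nat := \sum_(s < t) (cyc_value g s == v).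

Lemma cyc_countS g v t :
  cyc_count g v t.+1 = cyc_count g v t + (cyc_value g t == v).
Proof. by rewrite /cyc_count big_ord_recr. Qed.

Lemma cyc_count_window g v t :
  cyc_count g v (t + n) = cyc_count g v t + eta v (elt_fun (whirl_upto t g)).
Proof.
rewrite /cyc_count big_split_ord /=; congr (_ + _); rewrite eta_sum.
have inj : injective (fun s : 'I_n => cyc_index (t + s)).
  move=> r s /= e; apply/ord_inj.
  exact: cyc_index_inj (ltn_ord r) (ltn_ord s) e.
rewrite [RHS](reindex_inj inj); apply: eq_bigr => s _ /=.
by rewrite cyc_value_window.
Qed.

Lemma cyc_count_rows g v q :
  cyc_count g v (q * n) = \sum_(p < q) eta v (elt_fun ((whirl F ^+ p)%g g)).
Proof.
elim: q => [|q IHq]; first by rewrite /cyc_count !big_ord0.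
by rewrite mulSn addnC cyc_count_window IHq whirl_upto_rows big_ord_recr.
Qed.

Definition orbit_count g v : nat := \sum_(h in porbit (whirl F) g) eta v (elt_fun h).

(** Every lap of the orbit contributes the same total, wherever in the orbit it starts. *)
Lemma cyc_count_orbit g v r :
  cyc_count g v (r * #|porbit (whirl F) g| * n) = r * orbit_count g v.
Proof.
rewrite cyc_count_rows; elim: r => [|r IHr]; first by rewrite big_ord0.
rewrite mulSn addnC big_split_ord /= IHr [RHS]mulSn addnC; congr (_ + _).
set N := #|_|; set h := (whirl F ^+ (r * N))%g g.
have eO : porbit (whirl F) h = porbit (whirl F) g.
  by apply/eqP; rewrite eq_porbit_mem /h mem_porbit.
rewrite /orbit_count -eO sum_porbit eO; apply: eq_bigr => p _.
by rewrite expgD permM.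
Qed.

Lemma orbit_count_le g u v (C : int) :
    (forall t, (cyc_count g u t)%:Z - (cyc_count g v t)%:Z <= C)%R ->
  orbit_count g u <= orbit_count g v.
Proof.
(* Laps multiply the difference of the two orbit counts, so after [|C| + 1] of them a positive
   difference would exceed [C]. *)
move=> leC; have := leC (`|C|.+1 * #|porbit (whirl F) g| * n).
rewrite !cyc_count_orbit; nia.
Qed.

Lemma Inj_orbit_count_le m g v : F = Inj n k m ->
  orbit_count g v <= orbit_count g (ordS v).
Proof.
move=> FI.
pose E t := ((cyc_count g v t)%:Z - (cyc_count g (ordS v) t)%:Z)%R.
pose D t := (E t - (eta (ordS v) (elt_fun (whirl_upto t g)))%:Z)%R.
suff [C leC] : exists C, forall t, (E t <= C)%R by apply: orbit_count_le leC.
apply: (@delayed_bounded n m%:Z E D) => // t; rewrite /D /E.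
  rewrite !cyc_count_window; have := @Inj_elt m (whirl_upto t g) v FI; lia.
(* A replaced [ordS v] cancels out: [D] gains 1 if the old value is [v] and loses 1 if the new value
   is [ordS v]. *)
rewrite !cyc_countS.
have := eta_whirl_at (cyc_index t) (whirl_upto t g) (ordS v).
have := @Inj_whirl_at_skip m (cyc_index t) (whirl_upto t g) FI.
rewrite -whirl_uptoS -/(cyc_value g t).
case: (cyc_value g t =P v) => [->|_]; last by lia.
by case: eqP => [_|_ /(_ isT)]; lia.
Qed.

Lemma Sur_orbit_count_le g v : F = Sur n k 1 ->
  orbit_count g (ordS v) <= orbit_count g v.
Proof.
move=> FS.
pose E t := ((cyc_count g (ordS v) t)%:Z - (cyc_count g v t)%:Z)%R.
pose D t := (E t + (eta (ordS v) (elt_fun (whirl_upto t g)))%:Z)%R.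
suff [C leC] : exists C, forall t, (E t <= C)%R by apply: orbit_count_le leC.
apply: (@delayed_bounded n (-1)%R E D) => // t; rewrite /D /E.
  rewrite !cyc_count_window; have := @Sur_elt 1 (whirl_upto t g) v FS; lia.
(* Here [D] gains 1 if the new value is [ordS v] and loses 1 if the old one is [v]; a rise is thus a
   skip, by injectivity of [ordS]. *)
rewrite !cyc_countS.
have := eta_whirl_at (cyc_index t) (whirl_upto t g) (ordS v).
have := @Sur_whirl_at_skip (cyc_index t) (whirl_upto t g) FS.
rewrite -whirl_uptoS -/(cyc_value g t).
case: (cyc_value g t =P v) => [->|ne]; first by lia.
case: (elt_fun _ _ =P ordS v) => [->|_ _]; last by lia.
have -> : ordS v != ordS (cyc_value g t).
  by apply/eqP => /ordS_inj/esym.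
by move=> /(_ isT)[<- ->]; rewrite eqxx; lia.
Qed.

End Orbit.

End Whirl.

End Counting.

Theorem theorem2p10 (R : realFieldType) (n k m : nat)
    (n_gt0 : (0 < n)%N) (k_gt0 : (0 < k)%N) (m_gt0 : (0 < m)%N)
    (F : {set {ffun 'I_n -> 'I_k}})
    (hF : F = Inj n k m \/ F = Sur n k 1) (j : 'I_k) :
  mesic (whirl F) (n%:R / k%:R : R)%R
    (fun f : {f : {ffun 'I_n -> 'I_k} | f \in F} => (eta j (val f))%:R%R).
Proof.
move=> O /imsetP[g _ ->].
have c_const u v : orbit_count g u = orbit_count g v.
  (* Used with [leq] for [Inj] and [geq] for [Sur]; around the cycle of residues the relation holds
     in both directions. *)
  have ordS_le (r : rel nat) : reflexive r -> transitive r ->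
      (forall v, r (orbit_count g v) (orbit_count g (ordS v))) ->
      forall u v, r (orbit_count g u) (orbit_count g v).
    move=> rr rt; apply: (@ordS_chain k (relpre (orbit_count g) r)) => [x|].
      exact: rr.
    by move=> x y z; apply: rt.
  apply/eqP; rewrite eqn_leq; case: hF => hF.
    have le_c := ordS_le leq leqnn leq_trans
      (fun v => Inj_orbit_count_le n_gt0 g v hF).
    by rewrite !le_c.
  have ge_c := ordS_le geq leqnn (fun y x z xy yz => leq_trans yz xy)
    (fun v => Sur_orbit_count_le n_gt0 g v hF).
  by apply/andP; split; apply: ge_c.
(* Double counting: each function in the orbit has [n] values in all. *)
have sum_c : k * orbit_count g j = n * #|porbit (whirl F) g|.
  transitivity (\sum_u orbit_count g u).
    by rewrite (eq_bigr _ (fun u _ => c_const u j)) sum_nat_const card_ord.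
  rewrite exchange_big /= mulnC -sum_nat_const; apply: eq_bigr => h _.
  exact: sum_eta.
have N_gt0 : 0 < #|porbit (whirl F) g|.
  by apply/card_gt0P; exists g; apply: porbit_id.
rewrite -natr_sum -/(orbit_count g j).
apply/eqP; rewrite mulrC eqr_div ?pnatr_eq0 -?lt0n //.
by rewrite -!natrM mulnC sum_c.
Qed.
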